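(* Consider a Wardrop model on a finite directed network with admissible set $\mathcal A$ and cost $\tilde{\bm c}$. Suppose the cost $\tilde{\bm c}$ is strictly monotone on $\mathcal A$, i.e. $\langle \tilde{\bm c}(\bm\jmath_1)-\tilde{\bm c}(\bm\jmath_2),\bm\jmath_1-\bm\jmath_2\rangle>0$ for all $\bm\jmath_1,\bm\jmath_2\in\mathcal A$ with $\bm\jmath_1\neq\bm\jmath_2$. Then there is at most one Wardrop equilibrium.
   Context: $\tilde\Gamma=(\tilde E,\tilde V)$ is a finite directed network with $\tilde n$ edges $\tilde e_k$ and $\tilde m$ vertices $\tilde v_i$, of which the last $\tilde\mu$ are exit vertices; some other vertices are entrance vertices. A current distribution is $\bm\jmath=(\jmath_1,\dots,\jmath_{\tilde n})$; the cost vector is $\tilde{\bm c}(\bm\jmath)=(\tilde c_1(\bm\jmath),\dots,\tilde c_{\tilde n}(\bm\jmath))\in\mathbb R^{\tilde n}$. $\tilde K$ is the $(\tilde m-\tilde\mu)\times\tilde n$ Kirchhoff matrix with $\tilde K_{ik}=1$ if $\tilde e_k$ starts at $\tilde v_i$, $-1$ if $\tilde e_k$ ends at $\tilde v_i$, and $0$ otherwise ($\tilde v_i$ non-exit). $\tilde B\in\mathbb R^{\tilde m-\tilde\mu}$ has the prescribed positive entry currents at the entrance vertices and $0$ elsewhere. The admissible set is $\mathcal A=\{\bm\jmath\ge0:\tilde K\bm\jmath=\tilde B\}$. A Wardrop equilibrium is $\bm\jmath^*\in\mathcal A$ with $\langle\tilde{\bm c}(\bm\jmath^* ),\bm\jmath^*-\bm\jmath\rangle\le0$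 for all $\bm\jmath\in\mathcal A$, where $\langle\cdot,\cdot\rangle$ is the Euclidean inner product. *)

(* Defs.v *)
From mathcomp Require Import all_boot all_order all_algebra.
From mathcomp Require Import reals.

Set Implicit Arguments.
Unset Strict Implicit.
Unset Printing Implicit Defensive.

Import Order.TTheory GRing.Theory Num.Theory.
Local Open Scope ring_scope.

(* A network with n edges and m = p + mu vertices, the last mu of which are
   the exits: [lshift mu i] is the i-th non-exit vertex, [rshift p i] the i-th
   exit. Entrances are thus non-exit vertices by typing. Edges are indexed, so
   parallel edges are allowed. The value of [entry_current] outside [entrance]
   is never used. *)
Record network (R : realType) (n p mu : nat) := Network {
  edge_start : 'I_n -> 'I_(p + mu);
  edge_end : 'I_n -> 'I_(p + mu);
  entrance : {set 'I_p};
  entry_current : 'I_p -> R;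
  entry_current_gt0 : forall i, i \in entrance -> 0 < entry_current i
}.

Section Wardrop.
Variables (R : realType) (n p mu : nat).
Implicit Types (N : network R n p mu) (c : 'cV[R]_n -> 'cV[R]_n).
Implicit Types j u v : 'cV[R]_n.

Definition inner u v : R := \sum_(k < n) u k 0 * v k 0.

(* The entry is 1 if edge k starts at vertex i, -1 if it ends there and 0
   otherwise; the difference of indicators only adds the convention that a
   loop, if there is one, gives 0. *)
Definition kirchhoff N : 'M[R]_(p, n) :=
  \matrix_(i < p, k < n) ((edge_start N k == lshift mu i)%:R
                          - (edge_end N k == lshift mu i)%:R).

Definition entry_vector N : 'cV[R]_p :=
  \col_(i < p) (if i \in entrance N then entry_current N i else 0).

Definition admissible N j : Prop :=
  (forall k, 0 <= j k 0) /\ kirchhoff N *m j = entry_vector N.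

(* The cost is a total function, but only its values at admissible currents
   matter here and below. *)
Definition wardrop_equilibrium N c (jstar : 'cV[R]_n) : Prop :=
  admissible N jstar /\
  forall j, admissible N j -> inner (c jstar) (jstar - j) <= 0.

Definition strictly_monotone_on (A : 'cV[R]_n -> Prop) c : Prop :=
  forall j1 j2, A j1 -> A j2 -> j1 <> j2 ->
    0 < inner (c j1 - c j2) (j1 - j2).

End Wardrop.

(* Main.v *)
Require Import Defs.
From mathcomp Require Import all_boot all_order all_algebra.
From mathcomp Require Import reals.

Import Order.TTheory GRing.Theory Num.Theory.

(** Test each of two distinct equilibria against the other: both [inner (c j1) (j1 - j2)] and
    [inner (c j2) (j2 - j1)] are at most 0. By [innerBB] their sum is the pairing that strict
    monotonicity makes positive, a contradiction. *)

Lemma innerBB (R : realType) (n : nat) (a b u v : 'cV[R]_n) :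
  (inner (a - b) (u - v) = inner a (u - v) + inner b (v - u))%R.
Proof.
rewrite /inner -big_split; apply: eq_bigr => k _ /=.
by rewrite !mxE mulrBl -mulrN opprB.
Qed.

Theorem theorem2p8 (R : realType) (n p mu : nat) (N : network R n p mu)
    (c : 'cV[R]_n -> 'cV[R]_n)
    (hc : strictly_monotone_on (admissible N) c) :
  forall j1 j2 : 'cV[R]_n,
    wardrop_equilibrium N c j1 -> wardrop_equilibrium N c j2 -> j1 = j2.
Proof.
move=> j1 j2 [adm1 eq1] [adm2 eq2]; apply/eqP/negP => /negP/eqP neq12.
have := hc _ _ adm1 adm2 neq12; rewrite innerBB ltNge.
(* Writing the bound 0 as [0 + 0] lets each equilibrium inequality bound one summand. *)
by move/negP; apply; rewrite -[leRHS]addr0 lerD ?eq1 ?eq2.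
Qed.
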